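(* Let a $(V)$ pair consist of a connecting cell and a domino cell sharing a column. If every non-leaf of the domino cell lies, in position, between two consecutive skew components of the connecting cell, then the pair contains no occurrence of $1324$. The leaves of the domino cell may be placed arbitrarily.
   Context: A $(V)$ pair is a permutation whose points are partitioned into an upper cell and a lower cell, every point of the upper cell having larger value than every point of the lower cell (positions of the two cells interleave freely), where the upper cell avoids $213$ and the lower cell avoids $132$. One of the two cells (either the upper or the lower) is designated the connecting cell and the other the domino cell. Leaves: the leaves of a cell avoiding $213$ (the upper cell) are its right-to-left maxima, i.e. the points with no later larger point in the same cell; the leaves of a cell avoiding $132$ (the lower cell) are its left-to-right minima, i.e. the points with no earlier smaller point in the same cell. Non-leaves are the remaining points. Every permutation is uniquely a skew sum $c_1\ominus\cdots\ominus c_r$ of skew indecomposables, its skew components, which occupy consecutive position intervals and consecutive value intervals with earlier components holding larger values. A point of the domino cell lies ''between two consecutive skew components'' of the connecting cell if no skew component of the connecting cell has points both to its left and to its right; the two exterior positions, before all components and after all components, are allowed. *)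

(* Defs.v *)
From mathcomp Require Import all_boot all_fingroup.

Set Implicit Arguments.
Unset Strict Implicit.
Unset Printing Implicit Defensive.

(* A permutation is s : 'S_n; its points are identified with their positions
   i : 'I_n, the value of the point i being s i.  A cell is a set of points. *)

(* Patterns are written in one-line notation. *)
Definition contains n (s : 'S_n) (A : {set 'I_n}) (p : seq nat) : Prop :=
  exists f : 'I_(size p) -> 'I_n,
    [/\ forall a, f a \in A,
        forall a b : 'I_(size p), a < b -> f a < f b
      & forall a b : 'I_(size p),
          (s (f a) < s (f b)) = (nth 0 p a < nth 0 p b)].

Definition avoids n (s : 'S_n) (A : {set 'I_n}) (p : seq nat) : Prop :=
  ~ contains s A p.

(* U is the upper cell, its complement the lower one; either may be empty. *)
Definition V_pair n (s : 'S_n) (U : {set 'I_n}) : Prop :=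
  [/\ forall i j, i \in U -> j \notin U -> s j < s i,
      avoids s U [:: 2; 1; 3]
    & avoids s (~: U) [:: 1; 3; 2]].

Inductive side : Type := Upper | Lower.

Definition other (c : side) : side := if c is Upper then Lower else Upper.

Definition cell n (U : {set 'I_n}) (c : side) : {set 'I_n} :=
  if c is Upper then U else ~: U.

Definition rl_maximum n (s : 'S_n) (A : {set 'I_n}) (i : 'I_n) : Prop :=
  i \in A /\ ~ (exists j, [/\ j \in A, i < j & s i < s j]).

Definition lr_minimum n (s : 'S_n) (A : {set 'I_n}) (i : 'I_n) : Prop :=
  i \in A /\ ~ (exists j, [/\ j \in A, j < i & s j < s i]).

Definition leaf n (s : 'S_n) (U : {set 'I_n}) (c : side) (i : 'I_n) : Prop :=
  match c with
  | Upper => rl_maximum s (cell U Upper) i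
  | Lower => lr_minimum s (cell U Lower) i
  end.

Definition non_leaf n (s : 'S_n) (U : {set 'I_n}) (c : side) (i : 'I_n) :
    Prop :=
  i \in cell U c /\ ~ leaf s U c i.

Definition skew_before n (s : 'S_n) (A B : {set 'I_n}) : Prop :=
  forall i j, i \in A -> j \in B -> i < j /\ s j < s i.

Definition skew_indecomposable n (s : 'S_n) (A : {set 'I_n}) : Prop :=
  A <> set0 /\
  ~ (exists B C : {set 'I_n},
       [/\ B <> set0, C <> set0, A = B :|: C & skew_before s B C]).

(* cs = [:: c_1; ...; c_r] with A = c_1 (-) ... (-) c_r; disjointness of the
   c_k follows from skew_before. *)
Definition skew_decomposition n (s : 'S_n) (A : {set 'I_n})
    (cs : seq {set 'I_n}) : Prop :=
  [/\ A = \bigcup_(c <- cs) c,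
      forall k, k < size cs -> skew_indecomposable s (nth set0 cs k)
    & forall k l, k < l -> l < size cs ->
        skew_before s (nth set0 cs k) (nth set0 cs l)].

Definition skew_component n (s : 'S_n) (A D : {set 'I_n}) : Prop :=
  exists2 cs, skew_decomposition s A cs & D \in cs.

(* The exterior positions, before or after all components, are included. *)
Definition between_skew_components n (s : 'S_n) (A : {set 'I_n}) (i : 'I_n) :
    Prop :=
  forall D, skew_component s A D ->
    ~ ((exists2 j, j \in D & j < i) /\ (exists2 k, k \in D & i < k)).

(* Main.v *)
Require Import Defs.
From mathcomp Require Import all_boot all_fingroup.

(** In an occurrence of 1324 the lower points are the lowest in value.  If they
    are not exactly the 1 and the 2, then the upper cell contains the 213 formed
    by 324 or the lower cell contains the 132 formed by 132.  Otherwise the 2 is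
    a lower non-leaf lying between the 3 and the 4, and the 3 is an upper
    non-leaf lying between the 1 and the 2; whichever of them is in the domino
    cell, its two neighbours form an ascent of the connecting cell, and the ends
    of an ascent belong to the same skew component. *)

Set Implicit Arguments.
Unset Strict Implicit.
Unset Printing Implicit Defensive.

Section SkewSums.

Variables (n : nat) (s : 'S_n).
Implicit Types (A B C D : {set 'I_n}) (cs ds : seq {set 'I_n}).

Lemma skew_beforeP A B :
  reflect (skew_before s A B)
          [forall i in A, forall j in B, (i < j) && (s j < s i)].
Proof.
apply: (iffP forall_inP) => [h i j iA jB | h i iA].
  by apply/andP; move/forall_inP: (h i iA); apply.
by apply/forall_inP => j jB; apply/andP; exact: h.
Qed.

(** The subsets of ['I_n] form a finite type, so the existence of a splitting is a boolean and the
    case analysis needs no classical axiom. *)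
Lemma skew_decomposable_or_not A :
  A <> set0 ->
  skew_indecomposable s A \/
  exists B C, [/\ B <> set0, C <> set0, A = B :|: C & skew_before s B C].
Proof.
move=> A0.
case: (boolP [exists B : {set 'I_n}, exists C : {set 'I_n},
  [&& B != set0, C != set0, A == B :|: C
    & [forall i in B, forall j in C, (i < j) && (s j < s i)]]]).
  case/existsP=> B /existsP[C /and4P[/eqP B0 /eqP C0 /eqP AE /skew_beforeP h]].
  by right; exists B, C.
move=> noBC; left; split=> // -[B [C [/eqP B0 /eqP C0 /eqP AE /skew_beforeP h]]].
case/negP: noBC; apply/existsP; exists B; apply/existsP; exists C.
exact/and4P.
Qed.

Lemma skew_before_disjoint A B : skew_before s A B -> A :&: B = set0.
Proof.
move=> h; apply/setP=> i; rewrite !inE; apply/andP=> -[iA iB].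
by have [] := h i i iA iB; rewrite ltnn.
Qed.

(** An index below [size cs] selects a part of [A] and any other one a part of [B]. Mixed
    comparisons thus come from [skew_before s A B], the others from the two given decompositions. *)
Lemma skew_decomposition_cat A B cs ds :
  skew_before s A B -> skew_decomposition s A cs ->
  skew_decomposition s B ds -> skew_decomposition s (A :|: B) (cs ++ ds).
Proof.
move=> hAB [AE cs_ind cs_lt] [BE ds_ind ds_lt].
have subA k : k < size cs -> nth set0 cs k \subset A.
  by move=> lek; rewrite AE bigcup_seq; apply: bigcup_sup; exact: mem_nth.
have subB k : k < size ds -> nth set0 ds k \subset B.
  by move=> lek; rewrite BE bigcup_seq; apply: bigcup_sup; exact: mem_nth.
have drop_lt l : l < size (cs ++ ds) -> size cs <= l -> l - size cs < size ds.
  by rewrite size_cat => llt lel; rewrite ltn_subLR.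
split.
- by rewrite big_cat /= -AE -BE.
- move=> k klt; rewrite nth_cat; case: ltnP => lek; first exact: cs_ind.
  by apply: ds_ind; exact: drop_lt.
move=> k l kl llt; rewrite !nth_cat.
case: (ltnP l) => lel; first by rewrite (ltn_trans kl lel); exact: cs_lt.
case: ltnP => lek.
  move=> i j ik jl; apply: hAB; first exact: (subsetP (subA k lek)).
  exact: (subsetP (subB _ (drop_lt l llt lel))).
by apply: ds_lt; [exact: ltn_sub2r (leq_ltn_trans lek kl) kl | exact: drop_lt].
Qed.

(** Strong induction on the cardinality. Existence matters because [between_skew_components]
    quantifies over all components and would hold vacuously if there were none. *)
Lemma skew_decomposition_exists A : exists cs, skew_decomposition s A cs.
Proof.
have [m] := ubnP #|A|; elim: m A => // m IH A; rewrite ltnS => leAm.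
have [->|/eqP A0] := eqVneq A set0.
  by exists [::]; split=> //; rewrite big_nil.
case: (skew_decomposable_or_not A0) => [ind | [B [C [B0 C0 AE hBC]]]].
  exists [:: A]; split.
  - by rewrite big_seq1.
  - by case.
  - by move=> k [|l].
have cardA : #|A| = #|B| + #|C|.
  by rewrite AE cardsU skew_before_disjoint // cards0 subn0.
(* Each part is strictly smaller than [A] because the other one is nonempty. *)
move/eqP: B0; rewrite -card_gt0 => B0; move/eqP: C0; rewrite -card_gt0 => C0.
have [cs csB] : exists cs, skew_decomposition s B cs.
  by apply: IH; apply: leq_trans leAm; rewrite cardA -addn1 leq_add2l.
have [ds dsC] : exists ds, skew_decomposition s C ds.
  by apply: IH; apply: leq_trans leAm; rewrite cardA -add1n leq_add2r.
by exists (cs ++ ds); rewrite AE; exact: skew_decomposition_cat.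
Qed.

(** Two points in different components form a descent, so an ascent cannot straddle components. *)
Lemma ascent_in_skew_component A (i j : 'I_n) :
  i \in A -> j \in A -> i < j -> s i < s j ->
  exists D, [/\ skew_component s A D, i \in D & j \in D].
Proof.
move=> iA jA ij sij; have [cs csA] := skew_decomposition_exists A.
have [AE _ cs_lt] := csA.
have nth_of x : x \in A -> exists2 k, k < size cs & x \in nth set0 cs k.
  rewrite AE bigcup_seq => /bigcupP[D Dcs xD].
  by exists (index D cs); rewrite ?index_mem ?nth_index.
have [k klt ik] := nth_of i iA; have [l llt jl] := nth_of j jA.
case: (ltngtP k l) => [kl | lk | kl].
- by have [_ sji] := cs_lt k l kl llt i j ik jl; rewrite ltnNge ltnW in sji.
- by have [ji _] := cs_lt l k lk klt j i jl ik; rewrite ltnNge ltnW in ji.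
exists (nth set0 cs k); split; rewrite ?[in j \in _]kl //.
by exists cs => //; exact: mem_nth.
Qed.

Lemma ascent_not_between A (i x j : 'I_n) :
  i \in A -> j \in A -> i < x -> x < j -> s i < s j ->
  ~ between_skew_components s A x.
Proof.
move=> iA jA ix xj sij hx.
have [D [DA iD jD]] := ascent_in_skew_component iA jA (ltn_trans ix xj) sij.
by apply: (hx D DA); split; [exists i | exists j].
Qed.

Lemma contains_213 A (i j k : 'I_n) :
  [/\ i \in A, j \in A & k \in A] -> i < j < k -> s j < s i < s k ->
  contains s A [:: 2; 1; 3].
Proof.
move=> [iA jA kA] /andP[ij jk] /andP[ji ik].
exists (fun a => nth i [:: i; j; k] a); split.
- by case=> [[|[|[|]]]].
- by case=> [[|[|[|]]]] // ? [[|[|[|]]]] //= ? _; exact: ltn_trans jk.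
(* Of the nine pairs, the equal ones and the ascents close by rewriting; the reversed ascents remain
   and are refuted by asymmetry. *)
- by case=> [[|[|[|]]]] // ? [[|[|[|]]]] //= ?;
    rewrite ?ltnn ?ji ?ik ?(ltn_trans ji ik) //; apply/negbTE;
    rewrite -leqNgt ltnW ?(ltn_trans ji ik).
Qed.

Lemma contains_132 A (i j k : 'I_n) :
  [/\ i \in A, j \in A & k \in A] -> i < j < k -> s i < s k < s j ->
  contains s A [:: 1; 3; 2].
Proof.
move=> [iA jA kA] /andP[ij jk] /andP[ik kj].
exists (fun a => nth i [:: i; j; k] a); split.
- by case=> [[|[|[|]]]].
- by case=> [[|[|[|]]]] // ? [[|[|[|]]]] //= ? _; exact: ltn_trans jk.
- by case=> [[|[|[|]]]] // ? [[|[|[|]]]] //= ?;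
    rewrite ?ltnn ?ik ?kj ?(ltn_trans ik kj) //; apply/negbTE;
    rewrite -leqNgt ltnW ?(ltn_trans ik kj).
Qed.

Lemma contains_1324 A :
  contains s A [:: 1; 3; 2; 4] ->
  exists a b c d : 'I_n, [/\ a < b, b < c & c < d] /\
                         [/\ s a < s c, s c < s b & s b < s d].
Proof.
case=> f [_ f_lt f_val].
pose o m (h : m < 4) : 'I_(size [:: 1; 3; 2; 4]) := Ordinal h.
exists (f (o 0 isT)), (f (o 1 isT)), (f (o 2 isT)), (f (o 3 isT)).
by rewrite !f_val; split; split=> //; exact: f_lt.
Qed.

End SkewSums.

Theorem lemma3p1 (n : nat) (s : 'S_n) (U : {set 'I_n}) (connecting : side)
    (HV : V_pair s U)
    (Hbetween : forall i : 'I_n,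
        non_leaf s U (other connecting) i ->
        between_skew_components s (cell U connecting) i) :
  avoids s [set: 'I_n] [:: 1; 3; 2; 4].
Proof.
case: HV => U_above U213 L132.
move=> /contains_1324[a [b [c [d [[ab bc cd] [ac cb bd]]]]]].
(* The upper cell is closed upwards in value. *)
have upU i j : i \in U -> s i < s j -> j \in U.
  move=> iU sij; apply/negPn/negP=> jU.
  by have := U_above i j iU jU; rewrite ltnNge ltnW.
(* If [c] were upper, so would be the higher points [b] and [d], and [b], [c], [d] would form a
   213. *)
have cL : c \notin U.
  apply/negP=> cU; have bU := upU c b cU cb.
  apply: U213; apply: (@contains_213 n s U b c d).
  - by split=> //; exact: upU bU bd.
  - by rewrite bc.
  - by rewrite cb.
have aL : a \notin U by apply: contra cL => aU; exact: upU aU ac.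
have bU : b \in U.
  apply/negPn/negP=> bL; apply: L132; apply: (@contains_132 n s _ a b c).
  - by rewrite !inE.
  - by rewrite ab.
  - by rewrite ac.
have dU := upU b d bU bd.
case: connecting Hbetween => /= between.
(* Upper connecting cell: [c] is a non-leaf of the domino cell, witnessed by [a]. *)
- apply: (ascent_not_between bU dU bc cd bd); apply: between.
  split=> [|[_ []]]; first by rewrite inE.
  by exists a; rewrite inE; split=> //; exact: ltn_trans bc.
(* Lower connecting cell: [b] is a non-leaf of the domino cell, witnessed by [d]. *)
have aC : a \in ~: U by rewrite inE.
have cC : c \in ~: U by rewrite inE.
apply: (ascent_not_between aC cC ab bc ac); apply: between.
split=> [//|[_ []]].
by exists d; split=> //; exact: ltn_trans cd.
Qed.
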